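(* Let $n\geq2$, $s\geq\max\{2,6-n\}$, $m\geq1$, and $1\le d\leq ms$ be integers. Then $\left(n,D(d),m^{\times s^n}\right)$ is non-special. In particular, the linear series of degree-$d$ hypersurfaces in $\mathbb P^n$ based at $s^n$ general points with multiplicity at least $m$ at each is empty (i.e. for $s^n$ general points of $\mathbb P^n$ no nonzero homogeneous polynomial of degree $d$ in $n+1$ variables vanishes with multiplicity at least $m$ at every one of them).
   Context: $\mathbb K$ is a field of characteristic $0$ and $\mathbb P^n=\mathbb{KP}^n$. $D(d)=\{\mathbf a\in\mathbb N^{n+1}:a_0+\cdots+a_n=d\}$ indexes the monomials of degree $d$ in $\mathbb K[X_0,\ldots,X_n]$, so $\#D(d)=\binom{d+n}{n}$. $m^{\times r}$ denotes the $r$-tuple $(m,\ldots,m)$. ''General points'' means $(p_1,\ldots,p_r)$ in a suitable nonempty Zariski-open subset of $(\mathbb P^n)^r$. For $\mathbf m=(m_1,\ldots,m_r)$, $V^n(d,\mathbf m)$ is the space of homogeneous degree-$d$ polynomials in $\mathbb K[X_0,\ldots,X_n]$ vanishing with multiplicity at least $m_i$ at $p_i$ for each $i$, for general points $p_1,\ldots,p_r$. The triple $(n,D(d),\mathbf m)$ is non-special if $$\dim V^n(d,\mathbf m)=\max\Big\{\binom{d+n}{n}-\sum_{i=1}^r\binom{m_i+n-1}{n},\,0\Big\}.$$ *)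

(* Defs.v *)
From HB Require Import structures.
From mathcomp Require Import all_boot all_order all_algebra.
From mathcomp Require Export mpoly.

Set Implicit Arguments.
Unset Strict Implicit.
Unset Printing Implicit Defensive.

Import Order.TTheory GRing.Theory Num.Theory.
Local Open Scope ring_scope.

(* P^n(K): the set of lines through the origin of K^(n+1). *)
Definition projective_space (K : fieldType) (n : nat) : Type :=
  {L : {vspace 'rV[K]_n.+1} | \dim L == 1%N}.

(* One choice of homogeneous coordinates.  It is only used in conditions on
   (multi)homogeneous polynomials that are invariant under rescaling. *)
Definition hcoord (K : fieldType) (n : nat) (p : projective_space K n)
    (j : 'I_n.+1) : K :=
  vpick (val p) 0 j.

(* Polynomials on (P^n)^r have the r * (n + 1) variables X_(i,j), i < r, j <= n;
   X_(i,j) is the variable of index mxvec_index i j. *)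
Definition multihomogeneous (K : fieldType) (n r : nat)
    (F : {mpoly K[r * n.+1]}) : Prop :=
  exists e : 'I_r -> nat, forall a, a \in msupp F ->
    forall i : 'I_r, (\sum_(j < n.+1) a (mxvec_index i j))%N = e i.

Definition multi_hcoord (K : fieldType) (n r : nat)
    (p : 'I_r -> projective_space K n) (k : 'I_(r * n.+1)) : K :=
  mxvec (\matrix_(i < r, j < n.+1) hcoord (p i) j) 0 k.

(* Complement of the common zero locus of a set S of multihomogeneous
   polynomials. *)
Definition zariski_open (K : fieldType) (n r : nat)
    (U : ('I_r -> projective_space K n) -> Prop) : Prop :=
  exists2 S : {mpoly K[r * n.+1]} -> Prop,
    forall F, S F -> multihomogeneous F
  & forall p, U p <-> exists2 F, S F & F.@[multi_hcoord p] != 0.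

Definition for_general_points (K : fieldType) (n r : nat)
    (P : ('I_r -> projective_space K n) -> Prop) : Prop :=
  exists U : ('I_r -> projective_space K n) -> Prop,
    [/\ zariski_open U, exists p, U p & forall p, U p -> P p].

(* All partial derivatives of order < m vanish at p; this is used for
   homogeneous f in characteristic 0 only. *)
Definition vanishes_with_mult (K : fieldType) (n m : nat)
    (f : {mpoly K[n.+1]}) (p : projective_space K n) : Prop :=
  forall a : 'X_{1..n.+1}, (mdeg a < m)%N -> (mderivm a f).@[hcoord p] = 0.

Section DerivAt.
Variables (K : fieldType) (n d : nat) (p : projective_space K n).
Variable a : 'X_{1..n.+1}.

Definition deriv_at (f : dhomog n.+1 K d) : K^o :=
  (mderivm a (val f)).@[hcoord p].

Lemma deriv_at_is_linear : linear deriv_at.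
Proof.
by move=> c f g; rewrite /deriv_at /= mderivmD mderivmZ mevalD mevalZ.
Qed.

HB.instance Definition _ :=
  GRing.isLinear.Build K (dhomog n.+1 K d) K^o _ deriv_at deriv_at_is_linear.

End DerivAt.

(* V^n(d, m) at given points p_1, ..., p_r; see mem_interpolation_space. *)
Definition interpolation_space (K : fieldType) (n r d : nat)
    (m : r.-tuple nat) (p : 'I_r -> projective_space K n) :
    {vspace dhomog n.+1 K d} :=
  (\bigcap_(i < r) \bigcap_(a : 'X_{1..n.+1 < tnth m i})
     lker (linfun (@deriv_at K n d (p i) a)))%VS.

Lemma mem_interpolation_space (K : fieldType) (n r d : nat)
    (m : r.-tuple nat) (p : 'I_r -> projective_space K n)
    (f : dhomog n.+1 K d) :
  f \in interpolation_space d m p <->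
  forall i, vanishes_with_mult (tnth m i) (val f) (p i).
Proof.
rewrite memvE; split.
  move=> /subv_bigcapP fV i a lt_am.
  have /subv_bigcapP /(_ (BMultinom lt_am) isT) := fV i isT.
  by rewrite -memvE memv_ker lfunE /= => /eqP.
move=> fV; apply/subv_bigcapP => i _; apply/subv_bigcapP => a _.
rewrite -memvE memv_ker lfunE /=; apply/eqP; apply: fV; exact: bmdeg.
Qed.

(* 'C(m_i + n - 1, n) uses truncated subtraction, which is harmless for
   n >= 1; the difference of binomials is taken in int. *)
Definition nonspecial (K : fieldType) (n d r : nat) (m : r.-tuple nat) : Prop :=
  for_general_points (fun p : 'I_r -> projective_space K n =>
    (\dim (interpolation_space d m p))%:Z =
    Num.max ('C(d + n, n)%:Z - \sum_(i < r) 'C(tnth m i + n - 1, n)%:Z) 0).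
Arguments nonspecial K n d {r} m.

(* Main.v *)
Require Import Defs.
From mathcomp Require Import all_boot all_order all_algebra.
From HB Require Import structures.
From mathcomp Require Import perm fraction generic_quotient zify ring.
Import GRing.Theory.
Local Open Scope ring_scope.

Set Implicit Arguments.
Unset Strict Implicit.
Unset Printing Implicit Defensive.

(** There is no hypersurface of degree d with the prescribed multiplicities as
soon as some maximal minor of the matrix of interpolation conditions is
nonzero, an open condition on the points; so one good configuration is enough.
It also gives the dimension formula: a nonzero maximal minor forces at least as
many conditions as monomials, and both sides of the formula are 0.

The good configuration is a small displacement of the grid of all p with
coordinates in {0, ..., s-1}.  The grid itself is not good when d = m s: with
F = X (X - 1) ... (X - s + 1), every form of degree m in F(x_1), ..., F(x_n)
vanishes to order m on it.  These are the only such polynomials of degree at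
most m s, and a first-order displacement already destroys them.  Let p move to
p + t v_p and let f_0 + t f_1 + ... vanish to order m at the moved points.  Writing F^b
for the product of the F(x_j)^(b_j), and e_j for the j-th unit vector,
  f_0 = sum over |b| = m of c_b F^b, with constants c_b,
  f_1 = sum over |b| = m - 1 of g_b F^b, up to terms vanishing to order m,
with deg g_b <= s, and the derivatives of order b, |b| = m - 1, at p give
  g_b(p) + sum over j of (b_j + 1) c_(b + e_j) F'(p_j) v_(p,j) = 0.
The velocities v are chosen so that p |-> F'(p_j) v_(p,j) is, for each j, a
product of univariate Newton polynomials of total degree n (s - 1) - 1.  This
degree exceeds s exactly when (n - 1) (s - 1) >= 3, which for n >= 2 is the
hypothesis s >= max (2, 6 - n).  The products of Newton polynomials of degree
less than s in each variable are linearly independent as functions on the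
grid, so (b_j + 1) c_(b + e_j) = 0 for all b and j, and f_0 = 0 in
characteristic 0 (first_order_rigidity).

The two expansions come from one basis, the products of the polynomials
newton c; with respect to it Hermite interpolation on the grid is triangular
(newton_coef_eq0, leading_jet).  Consequently the interpolation matrix of the
moving points has no left kernel over K[t] (moving_family_eq0).  It then has a
maximal minor that is nonzero in K[t] (injective_family_minor), hence nonzero
at some value of t; the same minor, written in the homogeneous coordinates of
the points, is multihomogeneous and defines the open set. *)

(** * Newton polynomials with periodic nodes *)
Section NewtonPolynomials.
Variables (K : fieldType) (s : nat).

(** Newton polynomials for the nodes 0, ..., s-1 repeated periodically: newton s
is F, and newton (s * b + r) is F^b times the ordinary Newton polynomial of
degree r < s.  The order of vanishing at all nodes can thus be read off the
index. *)
Definition newton (c : nat) : {poly K} :=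
  \prod_(i < c) ('X - (i %% s)%:R%:P).

Lemma newtonD c : newton (s + c) = newton s * newton c.
Proof.
rewrite /newton big_split_ord /=; congr (_ * _).
by apply: eq_bigr => i _; rewrite modnDl.
Qed.

Lemma newtonMD b c : newton (s * b + c) = newton s ^+ b * newton c.
Proof.
elim: b => [|b IHb]; first by rewrite muln0 add0n expr0 mul1r.
by rewrite mulnS -addnA newtonD IHb exprS mulrA.
Qed.

Lemma newton_monic c : newton c \is monic.
Proof. exact: monic_prod_XsubC. Qed.

Lemma size_newton c : size (newton c) = c.+1.
Proof.
by rewrite size_prod_XsubC /index_enum -enumT size_enum_ord.
Qed.

Lemma horner_newton c x : (newton c).[x] = \prod_(i < c) (x - (i %% s)%:R).
Proof. by rewrite horner_prod; apply: eq_bigr => i _; rewrite hornerXsubC. Qed.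

Lemma newton_root c p : (p < s)%N -> (p < c)%N -> (newton c).[p%:R] = 0.
Proof.
move=> lt_ps lt_pc; rewrite horner_newton (bigD1 (Ordinal lt_pc)) //=.
by rewrite modn_small // subrr mul0r.
Qed.

(** Only the term in which each derivation hits a different factor F survives at
a root of F.  The induction moves one factor F and one derivation into g. *)
Lemma derivn_expM (F g : {poly K}) a b : F.[a] = 0 ->
  ((F ^+ b * g)^`(b)).[a] = b`!%:R * F^`().[a] ^+ b * g.[a].
Proof.
move=> Fa0; elim: b g => [|b IHb] g; first by rewrite derivn0 !expr0 !mul1r.
rewrite derivSn derivM deriv_exp /=.
have -> : F^`() * F ^+ b *+ b.+1 * g + F ^+ b.+1 * g^`() =
          F ^+ b * (F^`() * g *+ b.+1 + F * g^`()) by rewrite exprS; ring.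
rewrite IHb !hornerE hornerMn hornerM Fa0 factS natrM exprS -mulr_natr.
by ring.
Qed.

Hypothesis charK0 : [pchar K] =i pred0.

Lemma natr_eq0 k : (k%:R == 0 :> K) = (k == 0)%N.
Proof. by have /pcharf0P -> := charK0. Qed.

Lemma natr_sub_neq0 i j : i != j -> i%:R - j%:R != 0 :> K.
Proof.
by case: (ltngtP i j) => // lt_ij _; [rewrite -oppr_eq0 opprB|];
   rewrite -natrB ?natr_eq0 ?subn_eq0 -?ltnNge // ltnW.
Qed.

Lemma newton_neq0 c p : (p < s)%N -> (c <= p)%N -> (newton c).[p%:R] != 0.
Proof.
move=> lt_ps le_cp; rewrite horner_newton; apply/prodf_neq0 => i _.
have lt_ip := leq_trans (ltn_ord i) le_cp.
by rewrite modn_small ?(ltn_trans lt_ip) // natr_sub_neq0 // gtn_eqF.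
Qed.

Lemma deriv_newton_neq0 p : (p < s)%N -> (newton s)^`().[p%:R] != 0.
Proof.
move=> lt_ps; rewrite /newton (bigD1 (Ordinal lt_ps)) //= modn_small //.
rewrite derivM derivXsubC mul1r hornerD hornerM hornerXsubC subrr mul0r addr0.
rewrite horner_prod; apply/prodf_neq0 => i /negPf ne_ip.
rewrite hornerXsubC modn_small // natr_sub_neq0 // eq_sym.
by apply/eqP => eq_ip; case/eqP: ne_ip; apply: val_inj.
Qed.

(** The derivative of order b of F^b at the node p. *)
Definition hermite_scale b p : K := b`!%:R * (newton s)^`().[p%:R] ^+ b.

Lemma hermite_scale_neq0 b p : (p < s)%N -> hermite_scale b p != 0.
Proof.
move=> lt_ps; rewrite mulf_neq0 ?natr_eq0 -?lt0n ?fact_gt0 //.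
by rewrite expf_neq0 // deriv_newton_neq0.
Qed.

Lemma derivn_newton b c p : (p < s)%N -> (s * b <= c)%N ->
  ((newton c)^`(b)).[p%:R] = hermite_scale b p * (newton (c - s * b)).[p%:R].
Proof.
move=> lt_ps le_sbc; rewrite -{1}(subnKC le_sbc) newtonMD derivn_expM //.
exact: newton_root.
Qed.

(** Ordering the functionals u |-> u^(b)(p) by s b + p makes them triangular
against the newton c: this is confluent interpolation at periodic nodes. *)
Lemma derivn_newton_eq0 b c p : (p < s)%N -> (s * b + p < c)%N ->
  ((newton c)^`(b)).[p%:R] = 0.
Proof.
move=> lt_ps lt_c; rewrite derivn_newton //; last by lia.
by rewrite newton_root ?mulr0 //; lia.
Qed.

End NewtonPolynomials.

Lemma ltn_sum_pointwise (n : nat) (f g : 'I_n -> nat) j :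
    (forall l, f l <= g l)%N -> f j != g j ->
  (\sum_(l < n) f l < \sum_(l < n) g l)%N.
Proof.
move=> le_fg ne_fg; rewrite (bigD1 j) //= [X in (_ < X)%N](bigD1 j) //= -addSn.
by rewrite leq_add ?leq_sum // ltn_neqAle ne_fg le_fg.
Qed.

(** * Hermite interpolation on the grid *)

Section TensorNewton.
Variables (K : fieldType) (s n : nat).
Hypothesis charK0 : [pchar K] =i pred0.
Hypothesis s_gt0 : (0 < s)%N.

(** The partial derivative of order b, at the grid point p, of the product of the
newton (c j) in the j-th variables. *)
Definition jet (c b : 'I_n -> nat) (p : {ffun 'I_n -> 'I_s}) : K :=
  \prod_(j < n) ((newton K s (c j))^`(b j)).[(p j)%:R].

Definition divs (c : 'I_n -> nat) (j : 'I_n) : nat := c j %/ s.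
Definition mods (c : 'I_n -> nat) : {ffun 'I_n -> 'I_s} :=
  [ffun j => Ordinal (ltn_pmod (c j) s_gt0)].

Lemma jet_eq0 c b (p : {ffun 'I_n -> 'I_s}) j :
  (s * b j + p j < c j)%N -> jet c b p = 0.
Proof.
move=> lt_c; rewrite /jet (bigD1 j) //=.
by rewrite derivn_newton_eq0 ?mul0r.
Qed.

Lemma jet_diag_neq0 c : jet c (divs c) (mods c) != 0.
Proof.
apply/prodf_neq0 => j _; rewrite /divs ffunE /=.
have ltm := ltn_pmod (c j) s_gt0.
rewrite derivn_newton //; last by lia.
by rewrite mulf_neq0 ?hermite_scale_neq0 ?newton_neq0 //; lia.
Qed.

Variables (I : finType) (ex : I -> 'I_n -> nat).
Hypothesis ex_inj : forall i i', ex i =1 ex i' -> i = i'.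

(** Among the offending exponents choose c of minimal total degree, and apply the
functional with b = c div s and p = c mod s.  It kills every basis element
whose exponent is not below c; the exponents strictly below c also have a
quotient of degree less than k, so their coefficients vanish by minimality. *)
Lemma newton_coef_eq0 (la : I -> K) k :
    (forall p b, (\sum_(j < n) b j < k)%N -> \sum_i la i * jet (ex i) b p = 0) ->
  forall i, (\sum_(j < n) divs (ex i) j < k)%N -> la i = 0.
Proof.
move=> la_jet i; have [w] := ubnP (\sum_(j < n) ex i j)%N.
elim: w i => // w IHw i lt_w lt_k.
have := la_jet (mods (ex i)) _ lt_k; rewrite (bigD1 i) //= big1 ?addr0.
  by move/eqP; rewrite mulf_eq0 (negPf (jet_diag_neq0 _)) orbF => /eqP.
move=> i' ne_i'; have [le_i'|] := boolP [forall j, ex i' j <= ex i j]%N.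
  have {}le_i' j : (ex i' j <= ex i j)%N by have /forallP := le_i'; apply.
  rewrite IHw ?mul0r //; last first.
    by apply: leq_ltn_trans lt_k; apply: leq_sum => j _; apply: leq_div2r.
  have [/existsP[j ne_j]|] := boolP [exists j, ex i' j != ex i j].
    have lt_ex := @ltn_sum_pointwise _ (ex i') (ex i) j le_i' ne_j.
    exact: leq_trans lt_ex lt_w.
  rewrite negb_exists => /forallP eq_ex.
  by case/eqP: ne_i'; apply: ex_inj => j; apply/eqP; rewrite -[_ == _]negbK.
rewrite negb_forall => /existsP[j]; rewrite -ltnNge => lt_j.
rewrite (@jet_eq0 _ _ _ j) ?mulr0 //= ffunE /divs /= mulnC.
by rewrite -divn_eq.
Qed.

Definition bump_exp (b : 'I_n -> nat) (j l : 'I_n) : nat := (b l + (l == j))%N.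

Lemma sum_bump_exp b j :
  (\sum_(l < n) bump_exp b j l = (\sum_(l < n) b l).+1)%N.
Proof.
rewrite /bump_exp big_split /= -addn1; congr (_ + _)%N.
by rewrite (bigD1 j) //= eqxx big1 // => l /negPf->.
Qed.

Lemma sum_divs_mods c : (\sum_(l < n) c l =
  s * (\sum_(l < n) divs c l) + \sum_(l < n) mods c l)%N.
Proof.
rewrite big_distrr -big_split /=; apply: eq_bigr => l _.
by rewrite ffunE /= mulnC -divn_eq.
Qed.

Definition jet_scale b (p : {ffun 'I_n -> 'I_s}) : K :=
  \prod_(j < n) hermite_scale K s (b j) (p j).

Lemma jet_scale_neq0 b p : jet_scale b p != 0.
Proof. by apply/prodf_neq0 => j _; rewrite hermite_scale_neq0. Qed.

Lemma jet_scale_bump b p j : jet_scale (bump_exp b j) p =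
  jet_scale b p * ((b j).+1%:R * (newton K s s)^`().[(p j)%:R]).
Proof.
rewrite /jet_scale (bigD1 j) //= [in RHS](bigD1 j) //= /bump_exp eqxx addn1.
under eq_bigr => l /negPf-> do rewrite addn0.
by rewrite /hermite_scale factS natrM exprS; ring.
Qed.

Definition grid_newton (r p : {ffun 'I_n -> 'I_s}) : K :=
  \prod_(j < n) (newton K s (r j)).[(p j)%:R].

(** A basis element is a multiple of F^b', with b' the quotient of its exponent.
When only |b'| >= k = |b| occur, a derivative of order b at a grid point sees
the multiples with b' = b only, since any other b' has some b'_j > b_j. *)
Lemma leading_jet (la : I -> K) k b p :
    (forall i, (\sum_(j < n) divs (ex i) j < k)%N -> la i = 0) ->
    (\sum_(j < n) b j = k)%N ->
  \sum_i la i * jet (ex i) b p = jet_scale b p *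
    \sum_(i | [forall j, divs (ex i) j == b j])
        la i * grid_newton (mods (ex i)) p.
Proof.
move=> la0 sum_b; rewrite big_distrr [RHS]big_mkcond; apply: eq_bigr => i _ /=.
case: forallP => [eq_b|/forallP].
  rewrite [RHS]mulrCA -big_split; congr (_ * _); apply: eq_bigr => j _ /=.
  have eq_j : (s * b j + ex i j %% s = ex i j)%N.
    by rewrite -(eqP (eq_b j)) mulnC -divn_eq.
  rewrite derivn_newton // -?[X in (_ <= X)%N]eq_j ?leq_addr // ffunE /=.
  by rewrite -{1}eq_j addKn.
rewrite negb_forall => /existsP[j ne_j].
have [/la0->|] := ltnP (\sum_(j < n) divs (ex i) j) k; first by rewrite mul0r.
have [/forallP le_b|] := boolP [forall l, divs (ex i) l <= b l]%N.
  by rewrite -sum_b leqNgt (@ltn_sum_pointwise _ _ _ j).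
rewrite negb_forall => /existsP[l]; rewrite -ltnNge => lt_l _.
rewrite (@jet_eq0 _ _ _ l) ?mulr0 //.
move: lt_l; rewrite /divs leq_divRL // mulSn mulnC.
by have := ltn_ord (p l); lia.
Qed.

End TensorNewton.

(** The case of order k = 1 of newton_coef_eq0, in which the exponents are less
than s. *)
Lemma grid_newton_free (K : fieldType) (s n : nat) (y : {ffun 'I_n -> 'I_s} -> K) :
    [pchar K] =i pred0 -> (0 < s)%N ->
  (forall p, \sum_r y r * grid_newton K r p = 0) -> forall r, y r = 0.
Proof.
move=> charK0 s_gt0 y_free r.
apply: (@newton_coef_eq0 K s n charK0 s_gt0 _
  (fun (r : {ffun 'I_n -> 'I_s}) j => r j) _ y 1).
- by move=> r1 r2 eq_r; apply/ffunP => j; apply: val_inj; exact: eq_r.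
- move=> p b; rewrite ltnS leqn0 sum_nat_eq0 => /forallP b0.
  rewrite -[RHS](y_free p); apply: eq_bigr => r' _; congr (_ * _).
  by apply: eq_bigr => j _; have /eqP-> := b0 j.
by rewrite big1 // => j _; rewrite /divs divn_small.
Qed.

(** * First-order rigidity of the displaced grid *)

Section FirstOrder.
Variables (K : fieldType) (s n m d : nat).
Hypothesis charK0 : [pchar K] =i pred0.
Hypothesis s_gt0 : (0 < s)%N.

Lemma corner_proof (j l : 'I_n) : (s.-1 - (l == j) < s)%N.
Proof. by case: eqP => _; lia. Qed.

(** The n exponents next to the largest one (s-1, ..., s-1): their degree
n (s - 1) - 1 is larger than s as soon as (n - 1) (s - 1) >= 3, and then they
do not occur in the polynomials g_b, of degree at most s. *)
Definition corner (j : 'I_n) : {ffun 'I_n -> 'I_s} :=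
  [ffun l => Ordinal (corner_proof j l)].

Lemma sum_corner j : (1 < s)%N -> (\sum_(l < n) corner j l = n * s.-1 - 1)%N.
Proof.
move=> s_gt1; have j_lt := ltn_ord j.
rewrite (bigD1 j) //= ffunE /= eqxx.
rewrite (eq_bigr (fun=> s.-1)); last first.
  by move=> l /negPf ne_lj; rewrite ffunE /= ne_lj subn0.
rewrite sum_nat_const cardC1 card_ord.
have -> : (n * s.-1 = s.-1 + n.-1 * s.-1)%N by rewrite -mulSn prednK //; lia.
by move: (n.-1 * s.-1)%N => u; lia.
Qed.

Lemma corner_inj : (1 < s)%N -> injective corner.
Proof.
move=> s_gt1 j1 j2 /ffunP/(_ j1)/(congr1 val); rewrite !ffunE /= eqxx.
by case: eqP => //; lia.
Qed.

(** The division makes F'(p_j) v_(p,j) equal to the value at p of the Newton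
product of exponent corner j. *)
Definition velocity (p : {ffun 'I_n -> 'I_s}) (j : 'I_n) : K :=
  grid_newton K (corner j) p / (newton K s s)^`().[(p j)%:R].

Variables (I : finType) (ex : I -> 'I_n -> nat).
Hypothesis ex_inj : forall i i', ex i =1 ex i' -> i = i'.
Hypothesis ex_deg : forall i, (\sum_(j < n) ex i j <= d)%N.
Hypothesis m_gt0 : (0 < m)%N.
Hypothesis le_dms : (d <= m * s)%N.
Hypothesis n_s_large : (s + 1 < n * s.-1)%N.

(** The two hypotheses are the coefficients of t^0 and t^1 of the condition that
the polynomial with Newton coefficients la0 + t la1 + ... vanishes to order m
at the points p + t v_p. *)
Lemma first_order_rigidity (la0 la1 : I -> K) :
    (forall p b, (\sum_(j < n) b j < m)%N ->
       \sum_i la0 i * jet K (s := s) (ex i) b p = 0) ->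
    (forall p b, (\sum_(j < n) b j < m)%N ->
       \sum_i la1 i * jet K (ex i) b p +
       \sum_j velocity p j * \sum_i la0 i * jet K (ex i) (bump_exp b j) p = 0) ->
  forall i, la0 i = 0.
Proof.
move=> H0 H1 i0; apply/eqP; apply: contraT => la_i0.
have s_gt1 : (1 < s)%N by case: (s) s_gt0 n_s_large => [|[]] //=; rewrite muln0.
have la0_low i : (\sum_(j < n) divs s (ex i) j < m)%N -> la0 i = 0.
  exact: newton_coef_eq0 H0 i.
have la1_low i : (\sum_(j < n) divs s (ex i) j < m.-1)%N -> la1 i = 0.
  apply: (newton_coef_eq0 charK0 s_gt0 ex_inj) => p b lt_b.
  have := H1 p b (leq_trans lt_b (leq_pred _)).
  rewrite [X in _ + X]big1 ?addr0 // => j _.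
  by rewrite H0 ?mulr0 // sum_bump_exp; lia.
(* f_0 is a combination of the F^b with |b| = m: the degree d <= m s leaves no
   room for a nonzero remainder. *)
have la0_top i : la0 i != 0 -> (\sum_(j < n) divs s (ex i) j)%N = m /\
    forall l, mods s_gt0 (ex i) l = 0 :> nat.
  move=> nz; have ge_m : (m <= \sum_(j < n) divs s (ex i) j)%N.
    by rewrite leqNgt; apply: contraNN nz => /la0_low->.
  have := leq_trans (ex_deg i) le_dms; rewrite (sum_divs_mods s_gt0).
  move: ge_m; rewrite -(leq_pmul2l s_gt0) [(m * s)%N]mulnC => le1 le2.
  have /eqP : (\sum_(l < n) mods s_gt0 (ex i) l = 0)%N by lia.
  rewrite sum_nat_eq0 => /forallP mods0; split.
    by apply/eqP; rewrite -(eqn_pmul2l s_gt0); lia.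
  by move=> l; apply/eqP/(mods0 l).
have [sum_i0 mods_i0] := la0_top _ la_i0.
have [j0 j0_pos] : exists j, (0 < divs s (ex i0) j)%N.
  apply/existsP; rewrite -[[exists _, _]]negbK negb_exists; apply/negP => /forallP all0.
  by move: m_gt0; rewrite -sum_i0 big1 // => j _; have := all0 j; case: divs.
pose b l := (divs s (ex i0) l - (l == j0))%N.
have b_bump l : bump_exp b j0 l = divs s (ex i0) l.
  by rewrite /bump_exp /b; case: eqP => [->|_]; rewrite ?subnK ?subn0 ?addn0.
have sum_b : (\sum_(l < n) b l = m.-1)%N.
  by apply: succn_inj; rewrite -(sum_bump_exp b j0) prednK // -sum_i0; apply: eq_bigr.
have sum_bb j : (\sum_(l < n) bump_exp b j l = m)%N by rewrite sum_bump_exp sum_b prednK.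
(* C j is the coefficient c_(b + e_j), and Y r collects the coefficients of the
   Newton product of exponent r in the equation for the order b. *)
pose C j := \sum_(i | [forall l, divs s (ex i) l == bump_exp b j l]) la0 i.
pose Y r :=
  \sum_(i | [forall l, divs s (ex i) l == b l] && (mods s_gt0 (ex i) == r))
      la1 i +
  \sum_(j | corner j == r) (b j).+1%:R * C j.
have Y0 : forall r, Y r = 0.
  apply: grid_newton_free => // p.
  have lt_b : (\sum_(l < n) b l < m)%N by rewrite sum_b prednK.
  have C_term j : velocity p j * \sum_i la0 i * jet K (ex i) (bump_exp b j) p =
      jet_scale K b p * ((b j).+1%:R * C j * grid_newton K (corner j) p).
    rewrite (leading_jet s_gt0 _ la0_low (sum_bb j)).
    rewrite (eq_bigr la0) => [|i _]; last first.
      have [->|nz] := eqVneq (la0 i) 0; first by rewrite mul0r.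
      have [_ mods0] := la0_top _ nz; rewrite /grid_newton big1 ?mulr1 // => l _.
      by rewrite mods0 /newton big_ord0 hornerE.
    rewrite jet_scale_bump -[X in _ * (_ * X)]/(C j) /velocity.
    by field; apply: deriv_newton_neq0.
  have := H1 p b lt_b; rewrite (leading_jet s_gt0 _ la1_low sum_b).
  rewrite (eq_bigr _ (fun j _ => C_term j)).
  rewrite -big_distrr -mulrDr => /eqP.
  rewrite mulf_eq0 (negPf (jet_scale_neq0 charK0 _ _)) //=.
  move=> /eqP eqS; rewrite -[RHS]eqS; under eq_bigr do rewrite /Y mulrDl.
  rewrite big_split; congr (_ + _).
    rewrite [RHS](partition_big (fun i => mods s_gt0 (ex i)) xpredT) //=.
    apply: eq_bigr => r _; rewrite big_distrl; apply: eq_bigr => i /andP[_ /eqP->] //.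
  rewrite [RHS](partition_big corner xpredT) //=.
  by apply: eq_bigr => r _; rewrite big_distrl; apply: eq_bigr => j /eqP->.
(* The exponent corner j0 has degree larger than s, so f_1 does not contribute. *)
have := Y0 (corner j0); rewrite /Y big1 => [|i /andP[/forallP eq_b /eqP eq_m]]; last first.
  have := leq_trans (ex_deg i) le_dms; rewrite (sum_divs_mods s_gt0) eq_m sum_corner //.
  rewrite (eq_bigr b) => [|l _]; last exact/eqP.
  rewrite sum_b -{2}(prednK m_gt0) mulSn mulnC; lia.
rewrite add0r (big_pred1 j0) => [|j]; last exact: (inj_eq (corner_inj s_gt1)).
rewrite /C (bigD1 i0) /=; last by apply/forallP => l; rewrite b_bump.
rewrite big1 ?addr0 => [/eqP|i /andP[/forallP eq_i ne_i]].
  by rewrite mulf_eq0 natr_eq0 //= (negPf la_i0).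
apply/eqP; apply: contraNT ne_i => nz; apply/eqP/ex_inj => l.
have [_ mods0] := la0_top _ nz.
have := mods0 l; have := mods_i0 l; rewrite !ffunE /= => m1 m2.
rewrite (divn_eq (ex i l) s) (divn_eq (ex i0 l) s) m1 m2.
by have /eqP := eq_i l; rewrite b_bump /divs => ->.
Qed.

End FirstOrder.

(** * From monomials to the Newton basis *)

(** Exponents of the monomials of degree at most d in n affine variables; they
stand for the monomials of degree exactly d in n + 1 homogeneous variables.
They are encoded inside a box of finite functions because a sum of products
over the whole box is a product of univariate sums. *)
Definition expo (n d : nat) :=
  {a : {ffun 'I_n -> 'I_d.+1} | (\sum_(j < n) a j <= d)%N}.

Definition expn_of (n d : nat) (a : expo n d) (j : 'I_n) : nat := val a j.

Lemma expn_of_inj n d (a b : expo n d) : expn_of a =1 expn_of b -> a = b.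
Proof. by move=> eq_ab; apply/val_inj/ffunP => j; apply/val_inj/eq_ab. Qed.

Lemma expn_of_deg n d (a : expo n d) : (\sum_(j < n) expn_of a j <= d)%N.
Proof. exact: valP a. Qed.

(** The partial derivative of order b of the monomial of exponent a, at x. *)
Definition monomial_jet (R : comNzRingType) n (a b : 'I_n -> nat) (x : 'I_n -> R) : R :=
  \prod_(j < n) (('X^(a j))^`(b j)).[x j].

Lemma square_system_solvable (K : fieldType) (I : finType) (T : I -> I -> K) :
    (forall z : I -> K, (forall a, \sum_c z c * T c a = 0) -> forall c, z c = 0) ->
  forall f : I -> K, exists la : I -> K, forall a, f a = \sum_c la c * T c a.
Proof.
move=> T_inj f; pose M := \matrix_(k < #|I|, l < #|I|) T (enum_val k) (enum_val l).
have sumE (u : 'rV[K]_#|I|) l :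
    (u *m M) 0 l = \sum_c u 0 (enum_rank c) * T c (enum_val l).
  rewrite mxE (reindex enum_rank) /=; last exact/onW_bij/enum_rank_bij.
  by apply: eq_bigr => c _; rewrite mxE enum_rankK.
have M_unit : M \in unitmx.
  rewrite unitmxE unitfE; apply/det0P => -[v /eqP nz_v vM0]; apply: nz_v.
  apply/rowP => k; rewrite mxE -[k]enum_valK.
  apply: (T_inj (fun c => v 0 (enum_rank c))) => a.
  by rewrite -(enum_rankK a) -sumE vM0 mxE.
exists (fun c => ((\row_l f (enum_val l)) *m invmx M) 0 (enum_rank c)) => a.
by rewrite -{2}(enum_rankK a) -sumE mulmxKV // mxE enum_rankK.
Qed.

Section ChangeOfBasis.
Variables (K : fieldType) (s n d : nat).

Definition newton_coef (c a : expo n d) : K :=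
  \prod_(j < n) (newton K s (expn_of c j))`_(expn_of a j).

(** Each newton c is monic of degree c, so the change of basis is unitriangular
for the componentwise order. *)
Lemma newton_coef_inj (z : expo n d -> K) :
  (forall a, \sum_c z c * newton_coef c a = 0) -> forall c, z c = 0.
Proof.
move=> z_ker c; have [w] := ubnP (d - \sum_(j < n) expn_of c j)%N.
elim: w c => // w IHw c lt_w; have := z_ker c; rewrite (bigD1 c) //= big1 ?addr0.
  rewrite /newton_coef big1 ?mulr1 // => j _.
  by have /monicP := newton_monic K s (expn_of c j); rewrite lead_coefE size_newton.
move=> c' ne_c'; have [/forallP le_c|] := boolP [forall j, expn_of c j <= expn_of c' j]%N.
  have [/existsP[j ne_j]|] := boolP [exists j, expn_of c j != expn_of c' j].
    rewrite IHw ?mul0r //; have := ltn_sum_pointwise le_c ne_j.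
    by have := expn_of_deg c'; lia.
  rewrite negb_exists => /forallP eq_c; case/eqP: ne_c'; apply: expn_of_inj => j.
  by apply/esym/eqP; rewrite -[_ == _]negbK.
rewrite negb_forall => /existsP[j]; rewrite -ltnNge => lt_j.
by rewrite /newton_coef (bigD1 j) //= nth_default ?mul0r ?mulr0 // size_newton.
Qed.

(** Outside expo n d the box contributes nothing, because a monomial occurring in
a Newton product of exponent c lies below c. *)
Lemma newton_coef_jet c b (x : 'I_n -> K) :
  \sum_a newton_coef c a * monomial_jet (expn_of a) b x =
  \prod_(j < n) ((newton K s (expn_of c j))^`(b j)).[x j].
Proof.
pose G (j : 'I_n) (k : 'I_d.+1) := (newton K s (expn_of c j))`_k * (('X^k)^`(b j)).[x j].
have -> : \sum_a newton_coef c a * monomial_jet (expn_of a) b x =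
    \sum_(a : {ffun 'I_n -> 'I_d.+1}) \prod_j G j (a j).
  rewrite (bigID (fun a : {ffun 'I_n -> 'I_d.+1} => (\sum_(j < n) a j <= d)%N)) /=.
  rewrite [X in _ = _ + X]big1 ?addr0 => [|a gt_a]; last first.
    have [/forallP le_a|] := boolP [forall j, a j <= expn_of c j]%N.
      case/negP: gt_a; apply: leq_trans (expn_of_deg c).
      by apply: leq_sum => j _; apply: le_a.
    rewrite negb_forall => /existsP[j]; rewrite -ltnNge => lt_j.
    by rewrite (bigD1 j) //= /G nth_default ?mul0r // size_newton.
  rewrite [RHS]big_sub; apply: eq_bigr => a _.
  by rewrite /newton_coef /monomial_jet -big_split.
rewrite -bigA_distr_bigA; apply: eq_bigr => j _.
have le_size : (size (newton K s (expn_of c j)) <= d.+1)%N.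
  by rewrite size_newton ltnS -ltnS ltn_ord.
have -> : newton K s (expn_of c j) =
    \sum_(k < d.+1) (newton K s (expn_of c j))`_k *: 'X^k.
  rewrite -poly_def; apply/polyP => k; rewrite coef_poly.
  by case: ltnP => // le_dk; rewrite nth_default // (leq_trans le_size).
rewrite linear_sum horner_sum; apply: eq_bigr => k _.
by rewrite /= derivnZ hornerZ.
Qed.

Lemma newton_expansion (f : expo n d -> K) : exists2 la : expo n d -> K,
    forall b x, \sum_a f a * monomial_jet (expn_of a) b x =
      \sum_c la c * \prod_(j < n) ((newton K s (expn_of c j))^`(b j)).[x j]
  & (forall c, la c = 0) -> forall a, f a = 0.
Proof.
have [la f_la] := square_system_solvable newton_coef_inj f.
exists la => [b x|la0 a]; last by rewrite f_la big1 // => c _; rewrite la0 mul0r.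
under eq_bigr do rewrite f_la big_distrl /=.
rewrite exchange_big; apply: eq_bigr => c _ /=.
rewrite -newton_coef_jet big_distrr; apply: eq_bigr => a _ /=.
by rewrite mulrA.
Qed.

End ChangeOfBasis.

Lemma deriv_bigprod (R : comNzRingType) (I : eqType) (r : seq I) (q : I -> {poly R}) :
    uniq r ->
  (\prod_(l <- r) q l)^`() =
  \sum_(j <- r) \prod_(l <- r) (if l == j then (q l)^`() else q l).
Proof.
elim: r => [|i r IHr] /=; first by rewrite !big_nil derivC.
case/andP=> i_notin_r uniq_r; rewrite !big_cons eqxx derivM (IHr uniq_r) big_distrr /=.
congr (_ * _ + _).
  rewrite [LHS]big_seq [RHS]big_seq; apply: eq_bigr => l lr.
  by case: eqP => // eq_li; rewrite -eq_li lr in i_notin_r.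
rewrite [LHS]big_seq [RHS]big_seq; apply: eq_bigr => j jr; rewrite big_cons.
by case: eqP => // eq_ij; rewrite eq_ij jr in i_notin_r.
Qed.

(** * The displaced grid over K[t] *)

Section MovingPoint.
Variables (K : fieldType) (n : nat) (x v : 'I_n -> K).

Definition line_point (j : 'I_n) : {poly K} := (x j)%:P + v j *: 'X.

Lemma monomial_derivn_line a b j :
  (('X^a : {poly {poly K}})^`(b)).[line_point j] =
  ('X^a : {poly K})^`(b) \Po line_point j.
Proof.
by rewrite !derivnXn hornerMn hornerXn linearMn /= rmorphXn /= comp_polyX.
Qed.

Lemma line_point0 j : (line_point j).[0] = x j.
Proof. by rewrite !hornerE. Qed.

Lemma deriv_line_point j : (line_point j)^`() = (v j)%:P.
Proof. by rewrite !derivE add0r alg_polyC. Qed.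

Lemma monomial_jet_line0 a b :
  (monomial_jet a b line_point)`_0 = monomial_jet a b x.
Proof.
rewrite -horner_coef0 horner_prod; apply: eq_bigr => j _.
by rewrite monomial_derivn_line horner_comp line_point0.
Qed.

(** The chain rule: moving with velocity v adds one derivation in each direction
j, with weight v_j. *)
Lemma monomial_jet_line1 a b : (monomial_jet a b line_point)`_1 =
  \sum_j v j * monomial_jet a (bump_exp b j) x.
Proof.
rewrite -[LHS]mulr1n -coef_deriv -horner_coef0 deriv_bigprod ?index_enum_uniq //.
rewrite horner_sum; apply: eq_bigr => j _; rewrite horner_prod.
rewrite /monomial_jet (bigD1 j) //= [in RHS](bigD1 j) //= eqxx mulrA.
congr (_ * _).
  rewrite monomial_derivn_line deriv_comp -derivnS hornerM horner_comp.
  by rewrite line_point0 deriv_line_point hornerC mulrC /bump_exp eqxx addn1.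
apply: eq_bigr => l /negPf ne_lj; rewrite ne_lj /bump_exp ne_lj addn0.
by rewrite monomial_derivn_line horner_comp line_point0.
Qed.

End MovingPoint.

Section PolynomialFamily.
Variables (K : fieldType) (s n m d : nat).
Hypothesis charK0 : [pchar K] =i pred0.
Hypothesis s_gt0 : (0 < s)%N.
Hypothesis m_gt0 : (0 < m)%N.
Hypothesis le_dms : (d <= m * s)%N.
Hypothesis n_s_large : (s + 1 < n * s.-1)%N.

Definition moving_point (p : {ffun 'I_n -> 'I_s}) : 'I_n -> {poly K} :=
  line_point (fun j => (p j)%:R) (velocity K s_gt0 p).

Lemma moving_family_constant_term (F : expo n d -> {poly K}) :
    (forall p b, (\sum_(j < n) b j < m)%N ->
       \sum_a F a * monomial_jet (expn_of a) b (moving_point p) = 0) ->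
  forall a, (F a)`_0 = 0.
Proof.
move=> F0.
have [la0 la0E la0_0] := newton_expansion s (fun a => (F a)`_0).
have [la1 la1E _] := newton_expansion s (fun a => (F a)`_1).
apply: la0_0.
apply: (first_order_rigidity charK0 (@expn_of_inj n d) (@expn_of_deg n d) m_gt0 le_dms
   n_s_large (la1 := la1)) => p b lt_b; have /polyP Fpb := F0 p b lt_b.
  have := Fpb 0%N; rewrite coef0 coef_sum => Fpb0.
  rewrite -la0E -[RHS]Fpb0; apply: eq_bigr => a _.
  by rewrite coef0M monomial_jet_line0.
rewrite -la1E; under [X in _ + X]eq_bigr do rewrite -la0E.
have := Fpb 1%N; rewrite coef0 coef_sum => Fpb1; rewrite -[RHS]Fpb1.
under [RHS]eq_bigr do rewrite coefM big_ord_recr big_ord1 /= subnn subn0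
  monomial_jet_line0 monomial_jet_line1 addrC.
rewrite big_split /=; congr (_ + _).
under eq_bigr do rewrite big_distrr.
rewrite exchange_big; apply: eq_bigr => a _ /=; rewrite big_distrr.
by apply: eq_bigr => j _ /=; rewrite mulrCA.
Qed.

(** A kernel vector with zero constant terms is divisible by t, and the quotient
is again in the kernel; so all coefficients vanish in turn. *)
Lemma moving_family_eq0 (F : expo n d -> {poly K}) :
    (forall p b, (\sum_(j < n) b j < m)%N ->
       \sum_a F a * monomial_jet (expn_of a) b (moving_point p) = 0) ->
  forall a, F a = 0.
Proof.
move=> F0 a; apply/polyP => k; rewrite coef0.
elim: k F F0 a => [|k IHk] F F0 a; first exact: moving_family_constant_term.
have F_X a' : F a' = drop_poly 1 (F a') * 'X.
  rewrite -{1}(poly_take_drop 1 (F a')) expr1 [take_poly _ _](_ : _ = 0) ?add0r //.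
  apply/polyP => -[|l]; rewrite coef_take_poly coef0 //=.
  exact: moving_family_constant_term.
rewrite -addn1 -coef_drop_poly; apply: (IHk (fun a => drop_poly 1 (F a))) => p b lt_b.
apply: (mulIf (negbT (polyX_eq0 K))); rewrite mul0r -[RHS](F0 p b lt_b) big_distrl.
by apply: eq_bigr => a' _ /=; rewrite [in RHS]F_X mulrAC.
Qed.

End PolynomialFamily.

(** * Nonzero minors and counting *)

Lemma fraction_clear_denominator (R : idomainType) (x : {fraction R}) :
  exists nd : R * R, nd.2 != 0 /\ x * tofrac nd.2 = tofrac nd.1.
Proof.
elim/quotW: x => r; exists (frac r); split; first exact: denom_ratioP.
unlock FracField.tofrac; rewrite -[LHS]FracField.pi_mul.
apply/eqmodP; rewrite /= FracField.equivfE /FracField.mulf /=.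
by rewrite !numden_Ratio ?mulf_neq0 ?oner_neq0 ?denom_ratioP // !mulr1 mulrC.
Qed.

(** By clearing denominators, the absence of a left kernel passes to the fraction
field, where the rank of the matrix is then the number of its rows. *)
Lemma injective_family_minor (R : idomainType) (I J : finType) (M : I -> J -> R) :
    (forall F : I -> R, (forall j, \sum_i F i * M i j = 0) -> forall i, F i = 0) ->
  (#|I| <= #|J|)%N /\
  exists sigma : 'I_#|I| -> J,
    \det (\matrix_(k < #|I|, l < #|I|) M (enum_val k) (sigma l)) != 0.
Proof.
move=> M_inj.
pose A := \matrix_(k < #|I|, l < #|J|) tofrac (M (enum_val k) (enum_val l)).
have A_free : row_free A.
  rewrite -kermx_eq0; apply/rowV0Pn => -[v v_ker nz_v].
  have [nd nd_v] : exists nd : {ffun 'I_#|I| -> R * R},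
      forall k, (nd k).2 != 0 /\ v 0 k * tofrac (nd k).2 = tofrac (nd k).1.
    have [nd ndP] := fin_all_exists (fun k => fraction_clear_denominator (v 0 k)).
    by exists [ffun k => nd k] => k; rewrite ffunE.
  pose D := \prod_k (nd k).2.
  have D_neq0 : D != 0 by apply/prodf_neq0 => k _; case: (nd_v k).
  pose F i := (nd (enum_rank i)).1 * \prod_(k | k != enum_rank i) (nd k).2.
  have FE i : tofrac (F i) = v 0 (enum_rank i) * tofrac D.
    rewrite /F /D [in RHS](bigD1 (enum_rank i)) //= !tofracM mulrA.
    by have [_ ->] := nd_v (enum_rank i).
  case/eqP: nz_v; apply/rowP => k; rewrite mxE.
  apply: (mulIf (_ : tofrac D != 0)); first by rewrite tofrac_eq0.
  rewrite mul0r -[k]enum_valK -FE M_inj ?tofrac0 // => j.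
  apply/eqP; rewrite -tofrac_eq0 rmorph_sum /=; apply/eqP.
  have /rowP/(_ (enum_rank j)) := sub_kermxP v_ker.
  rewrite !mxE => vA; rewrite -[RHS](mul0r (tofrac D)) -[in RHS]vA big_distrl /=.
  rewrite [RHS](reindex enum_rank) /=; last exact/onW_bij/enum_rank_bij.
  by apply: eq_bigr => i _; rewrite tofracM FE mxE !enum_rankK mulrAC.
split; first by rewrite -(eqP A_free) rank_leq_col.
have At_full : row_full A^T by rewrite /row_full mxrank_tr.
exists (fun l => enum_val (fullrankfun At_full l)).
rewrite -tofrac_eq0 -det_map_mx -det_tr -unitfE -unitmxE.
have := fullrowsub_unit At_full; congr (_ \in unitmx).
by apply/matrixP => k l; rewrite !mxE.
Qed.

Lemma nonroot_exists (K : fieldType) (p : {poly K}) :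
  [pchar K] =i pred0 -> p != 0 -> exists t, p.[t] != 0.
Proof.
move=> charK0 nz_p.
pose rs : seq K := [seq k%:R | k <- iota 0 (size p)].
have [/hasP[t _ pt]|/hasPn p0] := boolP (has (fun t => p.[t] != 0) rs).
  by exists t.
have rs_roots : all (root p) rs by apply/allP => t /p0; rewrite negbK.
have rs_uniq : uniq rs.
  rewrite map_inj_uniq ?iota_uniq // => i j /eqP eq_ij; apply/eqP.
  by apply: contraLR eq_ij => /(natr_sub_neq0 charK0); rewrite subr_eq0.
by have := max_poly_roots nz_p rs_roots rs_uniq; rewrite size_map size_iota ltnn.
Qed.

Lemma card_expo n d : #|{: expo n d}| = 'C(d + n, n).
Proof.
rewrite card_sig addnC -card_partial_ord_partitions.
pose f (t : n.-tuple 'I_d.+1) := [ffun j => tnth t j].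
have f_inj : injective f.
  by move=> t1 t2 /ffunP eq_t; apply: eq_from_tnth => j; have := eq_t j; rewrite !ffunE.
rewrite -(card_imset _ f_inj) -[LHS]cardsE; congr #|pred_of_set _|.
apply/setP => a; rewrite inE; apply/idP/imsetP => [le_a|[t]]; last first.
  rewrite inE big_tuple => le_t ->; rewrite unfold_in.
  by under eq_bigr do rewrite ffunE.
exists [tuple a j | j < n]; last by apply/ffunP => j; rewrite ffunE tnth_mktuple.
by rewrite inE big_tuple; under eq_bigr do rewrite tnth_mktuple.
Qed.

Lemma expo_exists n d (b : 'I_n -> nat) : (\sum_(j < n) b j <= d)%N ->
  exists b' : expo n d, expn_of b' =1 b.
Proof.
move=> le_b; have b_lt j : (b j < d.+1)%N.
  by rewrite ltnS (leq_trans _ le_b) // (bigD1 j) //= leq_addr.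
pose b' : {ffun 'I_n -> 'I_d.+1} := [ffun j => Ordinal (b_lt j)].
have le_b' : (\sum_(j < n) b' j <= d)%N by under eq_bigr do rewrite ffunE.
by exists (exist _ b' le_b' : expo n d) => j; rewrite /expn_of /= ffunE.
Qed.

(** * The interpolation matrix in homogeneous coordinates *)

Section Homogenization.
Variables (n d : nat).

Definition homogenize (a : expo n d) : 'X_{1..n.+1} :=
  [multinom (if unlift ord0 j is Some l then expn_of a l
             else d - \sum_(l < n) expn_of a l)%N | j < n.+1].

(** Only derivations in the affine directions are used, so X_0 has exponent 0. *)
Definition affine_order (b : 'I_n -> nat) : 'X_{1..n.+1} :=
  [multinom (if unlift ord0 j is Some l then b l else 0%N) | j < n.+1].

Lemma homogenize0 a : homogenize a ord0 = (d - \sum_(l < n) expn_of a l)%N.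
Proof. by rewrite mnmE unlift_none. Qed.

Lemma homogenizeS a l : homogenize a (lift ord0 l) = expn_of a l.
Proof. by rewrite mnmE liftK. Qed.

Lemma affine_order0 b : affine_order b ord0 = 0%N.
Proof. by rewrite mnmE unlift_none. Qed.

Lemma affine_orderS b l : affine_order b (lift ord0 l) = b l.
Proof. by rewrite mnmE liftK. Qed.

Lemma mdeg_affine_order b : mdeg (affine_order b) = (\sum_(l < n) b l)%N.
Proof.
by rewrite mdegE big_ord_recl affine_order0 add0n; apply: eq_bigr => l _;
  rewrite affine_orderS.
Qed.

Lemma mdeg_homogenize a : mdeg (homogenize a) = d.
Proof.
rewrite mdegE big_ord_recl homogenize0.
rewrite [X in (_ + X)%N](eq_bigr (expn_of a)) => [|l _]; last exact: homogenizeS.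
by rewrite subnK // expn_of_deg.
Qed.

Lemma mdeg_homogenizeB a b : (affine_order b <= homogenize a)%MM ->
  mdeg (homogenize a - affine_order b)%MM = (d - \sum_(l < n) b l)%N.
Proof.
move=> le_ba; rewrite -mdeg_affine_order -(mdeg_homogenize a).
by rewrite -{2}(submK le_ba) mdegD addnK.
Qed.

Lemma homogenize_inj : injective homogenize.
Proof.
move=> a a' eq_a; apply: expn_of_inj => l.
by rewrite -!homogenizeS eq_a.
Qed.

Lemma homogenize_surj (M : 'X_{1..n.+1}) : mdeg M = d -> exists a, M = homogenize a.
Proof.
rewrite mdegE big_ord_recl => deg_M.
have [a aE] := @expo_exists n d (fun l => M (lift ord0 l))
  ltac:(by rewrite -deg_M leq_addl).
exists a; apply/mnmP => j; case: (unliftP ord0 j) => [l|] ->.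
  by rewrite homogenizeS aE.
by rewrite homogenize0 (eq_bigr _ (fun l _ => aE l)) -deg_M addnK.
Qed.

Lemma homogeneous_expansion (K : fieldType) (f : {mpoly K[n.+1]}) :
  f \is d.-homog -> f = \sum_(a : expo n d) f@_(homogenize a) *: 'X_[homogenize a].
Proof.
move=> f_homog; apply/mpolyP => M; rewrite raddf_sum /=.
have [/homogenize_surj[a ->]|/eqP ne_d] := mdeg M =P d.
  rewrite (bigD1 a) //= big1 ?addr0 => [|a' ne_a].
    by rewrite mcoeffZ mcoeffX eqxx mulr1.
  by rewrite mcoeffZ mcoeffX (inj_eq homogenize_inj) (negPf ne_a) mulr0.
rewrite (dhomog_nemf_coeff f_homog ne_d) big1 // => a _.
rewrite mcoeffZ mcoeffX; case: eqP => [eq_a|]; last by rewrite mulr0.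
by rewrite -eq_a mdeg_homogenize eqxx in ne_d.
Qed.

(** The homogeneous coordinates of a point are only known up to a factor la, and
each entry of the interpolation matrix scales by a power of la that does not
depend on the monomial; so kernel vectors are insensitive to the choice. *)
Lemma affine_deriv_scaled (K : fieldType) (a : expo n d) (b : 'I_n -> nat)
    (la : K) (x y : 'I_n.+1 -> K) :
    y ord0 = 1 -> (forall j, x j = la * y j) ->
  ('X_[homogenize a]^`M[affine_order b]).@[x] =
  la ^+ (d - \sum_(l < n) b l) * monomial_jet (expn_of a) b (fun l => y (lift ord0 l)).
Proof.
move=> y0 xE; rewrite mderivmX mevalZ mevalX.
have [le_ba|] := boolP (affine_order b <= homogenize a)%MM; last first.
  rewrite negb_forall => /existsP[j]; rewrite -ltnNge => lt_j.
  rewrite (bigD1 j) //= ffact_small // mul0n mul0r /monomial_jet.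
  move: lt_j; case: (unliftP ord0 j) => [l|] ->; last by rewrite affine_order0.
  rewrite homogenizeS affine_orderS => lt_l.
  by rewrite [X in _ = _ * X](bigD1 l) //= derivnXn ffact_small //
    mulr0n horner0 mul0r mulr0.
rewrite [X in _ * X](eq_bigr (fun j => la ^+ (homogenize a - affine_order b)%MM j *
    y j ^+ (homogenize a - affine_order b)%MM j)) => [|j _]; last by rewrite xE exprMn.
rewrite big_split /= prodrXr -mdegE mdeg_homogenizeB // mulrCA.
congr (_ * _); rewrite natr_prod -big_split big_ord_recl /= y0 expr1n mulr1.
rewrite affine_order0 ffactn0 mul1r /monomial_jet; apply: eq_bigr => l _.
by rewrite mnmBE homogenizeS affine_orderS derivnXn hornerMn hornerXn mulr_natl.
Qed.

(** The derivative of order b of the monomial homogenize a, at the i-th of r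
indeterminate points. *)
Definition generic_deriv (K : fieldType) r (a : expo n d) (i : 'I_r) (b : 'I_n -> nat) :
    {mpoly K[r * n.+1]} :=
  (\prod_j homogenize a j ^_ affine_order b j)%:R *:
  \prod_(j < n.+1) 'X_(mxvec_index i j) ^+ (homogenize a - affine_order b)%MM j.

Lemma generic_deriv_eval (K : fieldType) r a (i : 'I_r) b
    (p : 'I_r -> projective_space K n) :
  (generic_deriv K a i b).@[multi_hcoord p] =
  ('X_[homogenize a]^`M[affine_order b]).@[hcoord (p i)].
Proof.
rewrite mderivmX !mevalZ mevalX; congr (_ * _).
rewrite rmorph_prod; apply: eq_bigr => j _.
by rewrite rmorphXn /= mevalXU /multi_hcoord mxvecE mxE.
Qed.

End Homogenization.

(** The degree in the coordinates of the i-th point; as a measure on monomials it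
gives access to the theory of weighted homogeneous polynomials. *)
Definition block_deg (r n : nat) (i : 'I_r) (e : 'X_{1..r * n}) : nat :=
  \sum_(j < n) e (mxvec_index i j).

Lemma block_deg0 r n (i : 'I_r) : block_deg i (0 : 'X_{1..r * n}) = 0%N.
Proof. by rewrite /block_deg big1 // => j _; rewrite mnm0E. Qed.

Lemma block_degD r n (i : 'I_r) :
  {morph @block_deg r n i : e f / (e + f)%MM >-> (e + f)%N}.
Proof.
by move=> e f; rewrite /block_deg -big_split; apply: eq_bigr => j _; rewrite mnmDE.
Qed.

HB.instance Definition _ r n (i : 'I_r) :=
  isMeasure.Build (r * n)%N (@block_deg r n i) (block_deg0 n i) (@block_degD r n i).

Lemma dhomog_bigprod (R : comNzRingType) N (mf : measure N) (I : finType)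
    (q : I -> {mpoly R[N]}) (e : I -> nat) :
  (forall i, q i \is (e i).-homog for mf) ->
  \prod_i q i \is (\sum_i e i).-homog for mf.
Proof.
move=> q_homog; elim/big_rec2: _ => [|i d q' _ q'_homog]; first exact: dhomog1.
exact: dhomogM.
Qed.

Lemma multihomogeneous_dhomog (K : fieldType) r n (F : {mpoly K[r * n.+1]})
    (e : 'I_r -> nat) :
  (forall i : 'I_r, F \is (e i).-homog for (@block_deg r n.+1 i)) ->
  multihomogeneous F.
Proof.
by move=> F_homog; exists e => a a_F i; have /dhomogP/(_ _ a_F) := F_homog i.
Qed.

Lemma block_deg_var r n (i i' : 'I_r) (j : 'I_n) :
  block_deg i' U_(mxvec_index i j)%MM = (i == i').
Proof.
have idx_eq j' : (mxvec_index i j == mxvec_index i' j') = (i == i') && (j == j').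
  by apply/eqP/andP => [/cast_ord_inj/enum_rank_inj[-> ->]|[/eqP-> /eqP->]].
rewrite /block_deg (bigD1 j) //= big1 ?addn0 => [|j' /negPf ne_j].
  by rewrite mnm1E idx_eq eqxx andbT.
by rewrite mnm1E idx_eq [j == _]eq_sym ne_j andbF.
Qed.

Lemma generic_deriv_homog (K : fieldType) r n d (a : expo n d) (i i' : 'I_r) b :
  generic_deriv K a i b \is
    (if i == i' then d - \sum_(l < n) b l else 0)%N.-homog for (@block_deg r n.+1 i').
Proof.
rewrite /generic_deriv.
have [le_ba|] := boolP (affine_order b <= homogenize a)%MM; last first.
  rewrite negb_forall => /existsP[j]; rewrite -ltnNge => lt_j.
  by rewrite (bigD1 j) //= ffact_small // mul0n scale0r dhomog0.
apply: dhomogZ.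
have -> : (if i == i' then d - \sum_(l < n) b l else 0)%N =
    (\sum_(j < n.+1) (i == i') * (homogenize a - affine_order b)%MM j)%N.
  by rewrite -big_distrr /= -mdegE mdeg_homogenizeB //; case: eqP; rewrite ?mul1n ?mul0n.
apply: dhomog_bigprod => j; apply: dhomogMn; rewrite dhomogX.
by rewrite /= block_deg_var.
Qed.

Lemma homogeneous_deriv (K : fieldType) n d (f : {mpoly K[n.+1]}) b (x : 'I_n.+1 -> K) :
    f \is d.-homog -> f^`M[b].@[x] =
  \sum_(a : expo n d) f@_(homogenize a) * ('X_[homogenize a]^`M[b]).@[x].
Proof.
move=> f_homog; rewrite {1}(homogeneous_expansion f_homog) !linear_sum /=.
by apply: eq_bigr => a _; rewrite mderivmZ mevalZ.
Qed.

(** * The open set of good configurations *)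

Section InterpolationMinors.
Variables (K : fieldType) (n r m d : nat).
Hypothesis m_gt0 : (0 < m)%N.
(* For each column, the choice of one condition: a point and an order of
   derivation. *)
Variable sigma : 'I_#|{: expo n d}| -> 'I_r * expo n m.-1.

Definition interpolation_minor : {mpoly K[r * n.+1]} :=
  \det (\matrix_(k, l) generic_deriv K (enum_val k : expo n d) (sigma l).1
                         (expn_of (sigma l).2)).

(** The degree of an entry depends only on its column, and each term of the
determinant has one factor from every column. *)
Lemma interpolation_minor_multihomogeneous : multihomogeneous interpolation_minor.
Proof.
pose e i l := (if (sigma l).1 == i then d - \sum_(j < n) expn_of (sigma l).2 j else 0)%N.
apply: (@multihomogeneous_dhomog _ _ _ _ (fun i => \sum_l e i l)%N) => i.
rewrite /interpolation_minor /determinant rpred_sum // => w _.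
have -> : (\sum_l e i l = \sum_k e i (w k))%N by rewrite (reindex_inj (@perm_inj _ w)).
rewrite rpredMsign.
apply: dhomog_bigprod => k; rewrite mxE; exact: generic_deriv_homog.
Qed.

Lemma interpolation_minor_eval p : interpolation_minor.@[multi_hcoord p] =
  \det (\matrix_(k, l) ('X_[homogenize (enum_val k : expo n d)]
    ^`M[affine_order (expn_of (sigma l).2)]).@[hcoord (p (sigma l).1)]).
Proof.
rewrite -det_map_mx; congr (\det _); apply/matrixP => k l.
by rewrite !mxE /= generic_deriv_eval.
Qed.

(** The coefficients of f form a left kernel vector of the chosen square matrix. *)
Lemma nonvanishing_minor_forces_zero p f : interpolation_minor.@[multi_hcoord p] != 0 ->
  f \is d.-homog -> (forall i, vanishes_with_mult m f (p i)) -> f = 0.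
Proof.
rewrite interpolation_minor_eval => /det0P nz_minor f_homog f_van.
pose u : 'rV[K]_#|{: expo n d}| := \row_k f@_(homogenize (enum_val k)).
have u0 : u = 0.
  have [//|nz_u] := eqVneq u 0; case: nz_minor; exists u => //.
  apply/rowP => l; rewrite !mxE.
  have lt_b : (mdeg (affine_order (expn_of (sigma l).2)) < m)%N.
    by rewrite mdeg_affine_order; have := expn_of_deg (sigma l).2; lia.
  have := f_van (sigma l).1 _ lt_b; rewrite (homogeneous_deriv _ _ f_homog) => f0.
  rewrite -[RHS]f0 [RHS](reindex (fun k : 'I_#|{: expo n d}| => enum_val k)) /=.
    by apply: eq_bigr => k _; rewrite !mxE.
  exact/onW_bij/enum_val_bij.
rewrite (homogeneous_expansion f_homog) big1 // => a _.
have /rowP/(_ (enum_rank a)) := u0.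
by rewrite !mxE enum_rankK => ->; rewrite scale0r.
Qed.

End InterpolationMinors.

Lemma affine_point_exists (K : fieldType) n (y : 'I_n -> K) :
  exists P : projective_space K n, exists2 la : K, la != 0 &
    forall j, hcoord P j = la * (if unlift ord0 j is Some l then y l else 1).
Proof.
pose w : 'rV[K]_n.+1 := \row_j (if unlift ord0 j is Some l then y l else 1).
have nz_w : w != 0.
  by apply/eqP => /rowP/(_ ord0)/eqP; rewrite !mxE unlift_none oner_eq0.
have dim_w : \dim <[w]>%VS == 1%N by rewrite dim_vline nz_w.
exists (exist (fun L : {vspace 'rV[K]_n.+1} => \dim L == 1%N) _ dim_w).
have /vlineP[la laE] := memv_pick <[w]>%VS.
exists la; last by move=> j; rewrite /hcoord /= laE !mxE.
apply/eqP => la0; have := vpick0 <[w]>%VS.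
by rewrite laE la0 scale0r eqxx => /esym; rewrite -dimv_eq0 (eqP dim_w).
Qed.

Section GridPoints.
Variables (K : fieldType) (s n m d : nat).
Hypothesis charK0 : [pchar K] =i pred0.
Hypothesis s_gt0 : (0 < s)%N.
Hypothesis m_gt0 : (0 < m)%N.
Hypothesis le_dms : (d <= m * s)%N.
Hypothesis n_s_large : (s + 1 < n * s.-1)%N.

Lemma card_grid : (s ^ n)%N = #|{: {ffun 'I_n -> 'I_s}}|.
Proof. by rewrite card_ffun !card_ord. Qed.

Definition grid_point (i : 'I_(s ^ n)) : {ffun 'I_n -> 'I_s} :=
  enum_val (cast_ord card_grid i).

Lemma grid_point_surj p : exists i, grid_point i = p.
Proof.
exists (cast_ord (esym card_grid) (enum_rank p)).
by rewrite /grid_point cast_ordKV enum_rankK.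
Qed.

(** A nonzero minor over K[t] stays nonzero at some t in K, and the points
p + t v_p for that t are then a good configuration; the inequality of
cardinals comes from the independence of the rows. *)
Lemma nonvanishing_minor_exists :
  (#|{: expo n d}| <= #|{: 'I_(s ^ n) * expo n m.-1}|)%N /\
  exists sigma p, (@interpolation_minor K n (s ^ n) m d sigma).@[multi_hcoord p] != 0.
Proof.
have F_inj (F : expo n d -> {poly K}) :
    (forall jb : 'I_(s ^ n) * expo n m.-1,
       \sum_a F a * monomial_jet (expn_of a) (expn_of jb.2)
                      (moving_point K s_gt0 (grid_point jb.1)) = 0) ->
  forall a, F a = 0.
  move=> F0; apply: (moving_family_eq0 (s_gt0 := s_gt0) charK0 m_gt0 le_dms
    n_s_large) => p b lt_b.
  have [i <-] := grid_point_surj p.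
  have [b' b'E] := @expo_exists n m.-1 b ltac:(lia).
  rewrite -[RHS](F0 (i, b')) /=; apply: eq_bigr => a _; congr (_ * _).
  by apply: eq_bigr => j _; rewrite b'E.
have [card_le [sigma nz_det]] := injective_family_minor F_inj; split=> //.
have [t nz_t] := nonroot_exists charK0 nz_det.
pose y i l := (moving_point K s_gt0 (grid_point i) l).[t].
have [p pP] := fin_all_exists (fun i => affine_point_exists (y i)).
exists sigma, p; rewrite interpolation_minor_eval.
apply: contraNneq nz_t => det0.
have /eqP/det0P[u nz_u u_ker] := det0.
rewrite -horner_evalE -det_map_mx; apply/det0P; exists u => //.
apply/rowP => l; have /rowP/(_ l) := u_ker; rewrite !mxE.
have [la nz_la coord_p] := pP (sigma l).1.
set e := (d - \sum_(j < n) expn_of (sigma l).2 j)%N => sum0.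
apply: (mulfI (expf_neq0 e nz_la)); rewrite mulr0 -[RHS]sum0 big_distrr.
apply: eq_bigr => k _; rewrite !mxE /= mulrCA; congr (_ * _).
rewrite (@affine_deriv_scaled _ _ _ _ _ la _
  (fun j => if unlift ord0 j is Some l' then y (sigma l).1 l' else 1)) ?unlift_none //.
rewrite -/e; congr (_ * _); rewrite /horner_eval horner_prod.
apply: eq_bigr => j _; rewrite monomial_derivn_line horner_comp.
by rewrite liftK.
Qed.

End GridPoints.

Theorem theorem5p3 (K : fieldType) (charK0 : [pchar K] =i pred0)
    (n s m d : nat) (hn : (2 <= n)%N) (hs : (maxn 2 (6 - n) <= s)%N)
    (hm : (1 <= m)%N) (hd1 : (1 <= d)%N) (hd : (d <= m * s)%N) :
  nonspecial K n d (nseq_tuple (s ^ n) m) /\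
  for_general_points (fun p : 'I_(s ^ n) -> projective_space K n =>
    ~ exists f : {mpoly K[n.+1]},
        [/\ f != 0, f \is d.-homog &
            forall i, vanishes_with_mult m f (p i)]).
Proof.
have s_gt0 : (0 < s)%N by lia.
(* Equivalent to (n - 1) (s - 1) >= 3. *)
have n_s_large : (s + 1 < n * s.-1)%N.
  clear -hn hs s_gt0; have [n2|[n3|n4]] : n = 2 \/ n = 3 \/ (4 <= n)%N by lia.
  - by subst n; lia.
  - by subst n; lia.
  - by have := leq_mul2r s.-1 4 n; rewrite n4 orbT; lia.
have [card_le [sigma [p0 nz_p0]]] := nonvanishing_minor_exists charK0 s_gt0 hm hd n_s_large.
pose U (p : 'I_(s ^ n) -> projective_space K n) :=
  (interpolation_minor K sigma).@[multi_hcoord p] != 0.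
have U_open : zariski_open U.
  exists (fun F => F = interpolation_minor K sigma) => [F ->|p].
    exact: interpolation_minor_multihomogeneous.
  by split=> [Up|[F ->]] //; exists (interpolation_minor K sigma).
have U_empty p f : U p -> f \is d.-homog ->
    (forall i, vanishes_with_mult m f (p i)) -> f = 0.
  exact: nonvanishing_minor_forces_zero.
split; last first.
  exists U; split=> //; first by exists p0.
  move=> p Up [f [/eqP nz_f f_homog f_van]]; apply: nz_f.
  exact: U_empty Up f_homog f_van.
exists U; split=> //; first by exists p0.
move=> p Up; have -> : interpolation_space d (nseq_tuple (s ^ n) m) p = 0%VS.
  apply/eqP; rewrite -subv0; apply/subvP => f /mem_interpolation_space f_van.
  rewrite memv0; apply/eqP/val_inj; apply: U_empty Up (dhomog_is_dhomog f) _ => i.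
  by have := f_van i; rewrite tnth_nseq.
rewrite dimv0; apply/esym/Order.POrderTheory.max_idPr; rewrite Num.Theory.subr_le0.
rewrite (eq_bigr (fun=> 'C(m.-1 + n, n)%:Z)) => [|i _]; last first.
  by rewrite tnth_nseq -[in LHS](prednK hm) addSn subn1.
rewrite sumr_const card_ord -mulr_natl natz -PoszM lez_nat.
by rewrite -!card_expo -(card_ord (s ^ n)) -card_prod.
Qed.
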